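(* Fix a finite interval $\Lambda$ (with periodic boundary conditions) and suppose that $|\lambda|^2<(\kappa-2)/(2\kappa)$. Then for any $\nu>1$ (with $\nu|\Lambda|\in\mathbb{N}$), $$E_0(\nu|\Lambda|)\ \geq\ \nu|\Lambda|\left[\nu\left(1+\frac{\kappa}{2}-\kappa|\lambda|^2\right)-\frac{\kappa}{2}\right],$$ where $E_0(N)$ denotes the ground-state energy of $H_\Lambda^{\mathrm{per}}$ in the $N$-particle sector.
   Context: Standing assumptions: $\kappa>0$, $\lambda\in\mathbb{C}\setminus\{0\}$. For a finite interval $\Lambda=[a,b]=\{a,\dots,b\}\subset\mathbb{Z}$, $|\Lambda|=b-a+1$, viewed as a ring (site labels modulo $|\Lambda|$), let $\mathcal{H}_\Lambda=\ell^2(\mathbb{N}_0^\Lambda)$ with orthonormal basis $|\mu\rangle$, $\mu\in\mathbb{N}_0^\Lambda$, $\psi=\sum_\mu\psi(\mu)|\mu\rangle$. With $\delta_x$ the configuration having a single particle at $x$, $$(q_x\psi)(\nu)=\sqrt{(\nu_x+1)(\nu_x+2)}\,\psi(\nu+2\delta_x)-\lambda\sqrt{(\nu_{x-1}+1)(\nu_{x+1}+1)}\,\psi(\nu+\delta_{x-1}+\delta_{x+1}).$$ $H_\Lambda^{\mathrm{per}}$ is the non-negative self-adjoint operator associated (Friedrichs extension from finite linear combinations of the $|\mu\rangle$) with $$\langle\psi|H_\Lambda^{\mathrm{per}}\psi\rangle=\sum_{\mu}\Big(\sum_{x=a}^{b}\mu_x\mu_{x+1}\Big)|\psi(\mu)|^2+\kappa\sum_{\nu}\sum_{x=a}^{b}|(q_x\psi)(\nu)|^2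 .$$ It preserves each $N$-particle sector $\mathrm{span}\{|\mu\rangle:\sum_{x\in\Lambda}\mu_x=N\}$, which is finite-dimensional, and $E_0(N)$ is the smallest eigenvalue of $H_\Lambda^{\mathrm{per}}$ restricted to this sector. *)

(* Defs.v *)
From mathcomp Require Export all_boot all_order all_algebra.
From mathcomp Require Export all_classical all_reals all_analysis.
From mathcomp Require Export complex.

Set Implicit Arguments.
Unset Strict Implicit.
Unset Printing Implicit Defensive.

Import Order.TTheory GRing.Theory Num.Theory ComplexField.Normc.

Local Open Scope classical_set_scope.
Local Open Scope complex_scope.
Local Open Scope ring_scope.

(* |[a, b]| = b - a + 1 when a <= b. The site a + i of the ring is represented
   by i : 'I_(sites a b); its neighbours modulo |[a, b]| are [ord_pred i] and
   [ordS i]. *)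
Definition sites (a b : int) : nat := `|b - a|%N.+1.

Definition config (L : nat) := {ffun 'I_L -> nat}.

Definition delta (L : nat) (x : 'I_L) : config L := [ffun y => (y == x) : nat].

Definition particles (L : nat) (mu : config L) : nat := (\sum_x mu x)%N.

Definition pair_energy (L : nat) (mu : config L) : nat :=
  (\sum_x mu x * mu (ordS x))%N.

(* The state sum_mu psi(mu) |mu>, represented by its coefficients. *)
Definition state (R : realType) (L : nat) := config L -> R[i].

Definition sqnorm (R : realType) (L : nat) (psi : state R L) : \bar R :=
  \esum_(mu in [set: config L]) (normc (psi mu) ^+ 2)%:E.

Definition ell2 (R : realType) (L : nat) (psi : state R L) : Prop :=
  (sqnorm psi < +oo)%E.

(* Finite linear combinations of the |mu>. *)
Definition fin_comb (R : realType) (L : nat) (phi : state R L) : Prop :=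
  finite_set [set mu | phi mu != 0].

Definition q (R : realType) (L : nat) (lambda : R[i]) (x : 'I_L)
    (psi : state R L) : state R L := fun nu =>
  (Num.sqrt ((nu x + 1) * (nu x + 2))%N%:R)%:C * psi (nu + delta x *+ 2)
  - lambda
    * (Num.sqrt ((nu (ord_pred x) + 1) * (nu (ordS x) + 1))%N%:R)%:C
    * psi (nu + delta (ord_pred x) + delta (ordS x)).

Definition quad_form (R : realType) (L : nat) (kappa : R) (lambda : R[i])
    (psi : state R L) : \bar R :=
  (\esum_(mu in [set: config L])
      ((pair_energy mu)%:R * normc (psi mu) ^+ 2)%:E
   + kappa%:E * \esum_(nu in [set: config L])
      (\sum_x normc (q lambda x psi nu) ^+ 2)%:E)%E.

(* <phi | eta>, and below the polarization of [quad_form]. Both are used only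
   when phi is in [fin_comb], so that the sums have finitely many nonzero
   terms (a [\sum_(_ \in _)] with infinitely many of them is 0). *)
Definition inner (R : realType) (L : nat) (phi eta : state R L) : R[i] :=
  \sum_(mu \in [set: config L]) (phi mu)^* * eta mu.

Definition sesq_form (R : realType) (L : nat) (kappa : R) (lambda : R[i])
    (phi psi : state R L) : R[i] :=
  \sum_(mu \in [set: config L]) (pair_energy mu)%:R * ((phi mu)^* * psi mu)
  + kappa%:C * \sum_(nu \in [set: config L])
      \sum_x (q lambda x phi nu)^* * q lambda x psi nu.

(* Domain of the closure of the form on [fin_comb]: the closure of [fin_comb]
   for the form norm. This is the closure because [quad_form], being lower
   semicontinuous on ell2, is itself a closed form on {quad_form < +oo}. *)
Definition form_domain (R : realType) (L : nat) (kappa : R) (lambda : R[i])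
    (psi : state R L) : Prop :=
  forall eps : R, 0 < eps -> exists2 phi : state R L, fin_comb phi &
    (sqnorm (psi \- phi)%R + quad_form kappa lambda (psi \- phi)%R < eps%:E)%E.

(* The graph of the Friedrichs extension: psi is in the domain of H and
   H psi = eta. Testing against [fin_comb] suffices, since it is a form core. *)
Definition Hper (R : realType) (L : nat) (kappa : R) (lambda : R[i])
    (psi eta : state R L) : Prop :=
  [/\ ell2 psi, form_domain kappa lambda psi, ell2 eta &
      forall phi, fin_comb phi -> sesq_form kappa lambda phi psi = inner phi eta].

Definition in_sector (R : realType) (L N : nat) (psi : state R L) : Prop :=
  forall mu, psi mu != 0 -> particles mu = N.

(* H is self-adjoint, so its eigenvalues are real. *)
Definition sector_eigenvalues (R : realType) (L : nat) (kappa : R)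
    (lambda : R[i]) (N : nat) : set R :=
  [set E | exists psi : state R L,
     [/\ in_sector N psi, exists mu, psi mu != 0 &
         Hper kappa lambda psi (fun mu => E%:C * psi mu)]].

(* The smallest element of the set of eigenvalues; the default value 0 of
   [xget] plays no role, since each sector of a nonempty ring is
   finite-dimensional and nonzero. *)
Definition E0 (R : realType) (L : nat) (kappa : R) (lambda : R[i]) (N : nat)
    : R :=
  let S := sector_eigenvalues L kappa lambda N in xget 0 (S `&` lbound S).

(* Main.v *)
(* Since |u - v|^2 >= |u|^2 / 2 - |v|^2, the kinetic term dominates, after a shift
   of configurations, the diagonal operator whose entry at mu is the sum over x of
   kappa (mu_x (mu_x - 1) / 2 - |lambda|^2 mu_(x-1) mu_(x+1)). Hence the energy
   dominates a function of mu which is a translation-invariant quadratic form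
   minus kappa N / 2. Under the assumption on lambda this form is nonnegative on
   the fluctuations mu_x - nu, so that it is at least its value at the constant
   density nu, which gives the bound.
   The smallest eigenvalue exists because H acts on the N-particle sector as a
   finite matrix: its characteristic polynomial has finitely many roots, all of
   them real by the symmetry of the form. *)
Require Import Defs.
From mathcomp Require Import ring lra.
Import Order.TTheory GRing.Theory Num.Theory ComplexField.Normc.

Set Implicit Arguments.
Unset Strict Implicit.
Unset Printing Implicit Defensive.

Local Open Scope complex_scope.
Local Open Scope classical_set_scope.
Local Open Scope ring_scope.

(** * Moduli of complex numbers *)

Lemma normc_real (R : realType) (x : R) : normc x%:C = `|x|.
Proof. by rewrite /normc /= expr0n addr0 sqrtr_sqr. Qed.

Lemma normc_sqr_natsqrt (R : realType) (n : nat) (z : R[i]) :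
  normc ((Num.sqrt n%:R)%:C * z) ^+ 2 = n%:R * normc z ^+ 2.
Proof.
by rewrite normcM normc_real exprMn real_normK ?num_real// sqr_sqrtr.
Qed.

Lemma mulCJ (R : realType) (z : R[i]) : z^* * z = (normc z ^+ 2)%:C.
Proof. by rewrite -normCKC rmorphXn. Qed.

(** Square the triangle inequality for [u = (u - v) + v] and use [(a + b)^2 <= 2 a^2 + 2 b^2]. *)
Lemma normc_sqrB_ge (R : realType) (u v : R[i]) :
  normc u ^+ 2 / 2 - normc v ^+ 2 <= normc (u - v) ^+ 2.
Proof.
have := @le_normcD R (u - v) v; rewrite subrK.
have n0 (z : R[i]) : 0 <= normc z by case: z => x y; exact: sqrtr_ge0.
have := n0 u; have := n0 v; have := n0 (u - v).
set a := normc (u - v); set b := normc v; set c := normc u.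
move=> a0 b0 c0 cab.
have : c ^+ 2 <= (a + b) ^+ 2 by rewrite ler_sqr ?nnegrE ?addr_ge0.
by have := sqr_ge0 (a - b); nra.
Qed.

(** * A translation-invariant quadratic form on the ring *)

Section QuadraticForm.
Context (R : realType) (L : nat).

Lemma sum_ordS (V : nmodType) (f : 'I_L -> V) :
  \sum_x f (ordS x) = \sum_x f x.
Proof. by rewrite [RHS](reindex_inj (bij_inj (@ordS_bij L))). Qed.

Lemma sum_ord_pred (V : nmodType) (f : 'I_L -> V) :
  \sum_x f (ord_pred x) = \sum_x f x.
Proof. by rewrite [RHS](reindex_inj (bij_inj (@ord_pred_bij L))). Qed.

(* The quadratic form is translation invariant, with symbol
   cos k + c / 2 - l cos (2 k); only the mode k = 0 is bounded from below by
   more than c / 2 - 1 - l. *)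
Lemma density_form_ge (c l nu : R) (n : 'I_L -> R) :
  0 <= l -> 0 <= c / 2 - 1 - l -> \sum_x n x = nu * L%:R ->
  nu * L%:R * (nu * (1 + c / 2 - l)) <=
  \sum_x (n x * n (ordS x) + c / 2 * n x ^+ 2
          - l * (n (ord_pred x) * n (ordS x))).
Proof.
move=> l0 cl0 sum_n.
have sumD : \sum_x (n x - nu) = 0.
  by rewrite sumrB sum_n sumr_const card_ord -[nu *+ L]mulr_natr subrr.
pose m x := n x - nu.
(* The form at the fluctuations [m] as a sum of squares: the first two squares carry the cross
   terms, and after shifts of the index their diagonal parts give [1 + l], which the last one
   completes to [c / 2]. *)
have : 0 <= \sum_x ((m x + m (ordS x)) ^+ 2 / 2
                    + l * (m (ord_pred x) - m (ordS x)) ^+ 2 / 2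
                    + (c / 2 - 1 - l) * m x ^+ 2).
  apply: sumr_ge0 => x _.
  have := sqr_ge0 (m x + m (ordS x)).
  have := mulr_ge0 l0 (sqr_ge0 (m (ord_pred x) - m (ordS x))).
  by have := mulr_ge0 cl0 (sqr_ge0 (m x)); lra.
suff -> : \sum_x ((m x + m (ordS x)) ^+ 2 / 2
                    + l * (m (ord_pred x) - m (ordS x)) ^+ 2 / 2
                    + (c / 2 - 1 - l) * m x ^+ 2) =
  \sum_x (n x * n (ordS x) + c / 2 * n x ^+ 2
          - l * (n (ord_pred x) * n (ordS x)))
  - nu * L%:R * (nu * (1 + c / 2 - l)) by rewrite subr_ge0.
(* The identity holds only after summation. Its pointwise defect is split into terms attached to
   [ordS x], [ord_pred x] and [x]; once shifted to the same site, the squares cancel and a multiple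
   of [n x - nu] remains, whose sum is zero. *)
pose g1 x := (1 + l) / 2 * m x ^+ 2 - (1 - l) * nu * m x.
pose g2 x := l / 2 * m x ^+ 2 + l * nu * m x.
pose g3 x := - (1 / 2 + l) * m x ^+ 2 - nu * (1 + c) * m x.
transitivity (\sum_x ((n x * n (ordS x) + c / 2 * n x ^+ 2
          - l * (n (ord_pred x) * n (ordS x))) - nu * (nu * (1 + c / 2 - l))
   + (g1 (ordS x) + g2 (ord_pred x) + g3 x))).
  by apply: eq_bigr => x _; rewrite /g1 /g2 /g3 /m; field.
have g0 : \sum_x (g1 (ordS x) + g2 (ord_pred x) + g3 x) = 0.
  rewrite 2!big_split/= (sum_ordS g1) (sum_ord_pred g2) -2!big_split/=.
  transitivity ((- nu * (2 + c - 2 * l)) * \sum_x (n x - nu)); last first.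
    by rewrite sumD mulr0.
  rewrite mulr_sumr; apply: eq_bigr => x _.
  by rewrite /g1 /g2 /g3 /m; field.
rewrite big_split/= g0 addr0 sumrB sumr_const card_ord.
by congr (_ - _); rewrite -[LHS]mulr_natr; ring.
Qed.

End QuadraticForm.

(** * Particle number and sums over shifted configurations *)

Section Configurations.
Context (L : nat).
Implicit Types (mu nu d : config L) (N : nat).

Lemma configDE mu nu x : (mu + nu) x = (mu x + nu x)%N.
Proof. by rewrite ffunE. Qed.

Lemma particlesD mu nu : particles (mu + nu) = (particles mu + particles nu)%N.
Proof.
by rewrite /particles -big_split; apply: eq_bigr => x _; rewrite configDE.
Qed.

Lemma particles_delta (x : 'I_L) : particles (delta x) = 1%N.
Proof.
rewrite /particles (bigD1 x)//= ffunE eqxx big1 ?addn0// => y yx.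
by rewrite ffunE (negbTE yx).
Qed.

Lemma leq_particles mu x : (mu x <= particles mu)%N.
Proof. by rewrite /particles (bigD1 x)//= leq_addr. Qed.

Lemma finite_particles_le N :
  finite_set [set mu : config L | (particles mu <= N)%N].
Proof.
pose emb (f : {ffun 'I_L -> 'I_N.+1}) : config L := [ffun x => f x : nat].
apply: (@sub_finite_set _ _ (emb @` setT)); last first.
  exact/finite_image/finite_finset.
move=> mu /= muN; exists [ffun x => inord (mu x)] => //.
apply/ffunP => x; rewrite !ffunE inordK// ltnS.
exact: leq_trans (leq_particles _ _) muN.
Qed.

(** The bound is [<= N] rather than [= N] because [q] lowers the particle number by two: one list
    serves both an N-particle state and its images under [q]. *)
Definition configs_le N : seq (config L) :=
  finmap.enum_fset (fset_set [set mu : config L | (particles mu <= N)%N]).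

Lemma mem_configs_le N mu : (mu \in configs_le N) = (particles mu <= N)%N.
Proof.
rewrite /configs_le.
by rewrite (in_fset_set (finite_particles_le N)); apply/idP/idP; rewrite inE.
Qed.

Lemma sum_configs_le (V : nmodType) N (f : config L -> V) :
    (forall mu, f mu != 0 -> (particles mu <= N)%N) ->
  \sum_(mu \in [set: config L]) f mu = \sum_(mu <- configs_le N) f mu.
Proof.
move=> fN; apply: fsbigTE => mu; rewrite -/(configs_le N) => muN.
apply/eqP; apply: contraNT muN => /fN.
by rewrite -mem_configs_le.
Qed.

(** The support bound lets both sums run over all configurations; then adding [d] is an injective
    reindexing, and [g] vanishes off its range. *)
Lemma sum_shift (V : nmodType) N d (g : config L -> V) :
    (forall mu, g mu != 0 -> (particles mu <= N)%N) ->
    (forall mu, g mu != 0 -> exists nu, mu = nu + d) ->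
  \sum_(nu <- configs_le N) g (nu + d) = \sum_(mu <- configs_le N) g mu.
Proof.
move=> gN gd; rewrite -!sum_configs_le//; last first.
  by move=> mu /gN; rewrite particlesD; apply: leq_trans; rewrite leq_addr.
rewrite -[RHS](fsbig_widen (range (+%R^~ d)))//; last first.
  move=> mu [_ /= mud]; apply/eqP/negPn/negP => /gd[nu mu_eq].
  by apply: mud; exists nu.
apply/esym; apply: reindex_fsbig; apply: inj_bij => mu nu _ _ /= /ffunP eq_mu.
apply/ffunP => x; have := eq_mu x; rewrite !configDE.
by move/eqP; rewrite eqn_add2r => /eqP.
Qed.

Lemma sum_shift_le (R : realType) N d (g : config L -> R) :
    (forall mu, 0 <= g mu) -> (forall mu, g mu != 0 -> (particles mu <= N)%N) ->
  \sum_(nu <- configs_le N) g (nu + d) <= \sum_(mu <- configs_le N) g mu.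
Proof.
(* Cutting [g] off outside the range of the shift reduces to the equality and can only decrease the
   right-hand sum. *)
move=> g0 gN; pose g' mu := if `[< exists nu, mu = nu + d >] then g mu else 0.
rewrite (eq_bigr (fun nu => g' (nu + d))) => [|nu _]; last first.
  by rewrite /g' ifT//; apply/asboolP; exists nu.
rewrite sum_shift; first by apply: ler_sum => mu _; rewrite /g'; case: ifP.
- by move=> mu; rewrite /g'; case: ifP => [_ /gN//|]; rewrite eqxx.
- by move=> mu; rewrite /g'; case: asboolP => //; rewrite eqxx.
Qed.

Lemma particlesMn mu k : particles (mu *+ k) = (particles mu * k)%N.
Proof.
elim: k => [|k IH]; last by rewrite mulrS particlesD IH mulnS.
by rewrite mulr0n muln0 /particles big1// => x _; rewrite ffunE.
Qed.

End Configurations.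

(** * The form on the N-particle sector and its lower bound *)

Section Sector.
Context (R : realType) (L : nat).
Variables (kappa : R) (lambda : R[i]).
Implicit Types (phi psi : state R L) (mu nu : config L) (N : nat).

Lemma particles_pair (x y : 'I_L) : particles (delta x + delta y) = 2.
Proof. by rewrite particlesD !particles_delta. Qed.

Lemma q_eq0 N psi x nu :
  in_sector N psi -> (particles nu + 2)%N != N -> q lambda x psi nu = 0.
Proof.
move=> psiN nuN; have psi0 d : particles d = 2 -> psi (nu + d) = 0.
  move=> d2; apply/eqP; apply: contraNT nuN => /psiN.
  by rewrite particlesD d2 => ->.
by rewrite /q -addrA mulr2n !psi0 ?particles_pair// !mulr0 subrr.
Qed.

(** Projection onto the sector. Paired with a sector state, a test vector matters only through this
    part, so arbitrary test vectors reduce to sector ones. *)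
Definition truncate N phi : state R L :=
  fun mu => if particles mu == N then phi mu else 0.

Lemma in_sector_truncate N phi : in_sector N (truncate N phi).
Proof.
by move=> mu; rewrite /truncate; have [|] := eqVneq (particles mu) N;
  rewrite ?eqxx.
Qed.

Lemma q_truncate N phi x nu :
  (particles nu + 2)%N = N ->
  q lambda x (truncate N phi) nu = q lambda x phi nu.
Proof.
move=> nuN.
have trE d : particles d = 2 -> truncate N phi (nu + d) = phi (nu + d).
  by move=> d2; rewrite /truncate particlesD d2 nuN eqxx.
by rewrite /q -addrA mulr2n !trE ?particles_pair.
Qed.

Lemma inner_truncate N phi psi :
  in_sector N psi -> inner phi psi = inner (truncate N phi) psi.
Proof.
move=> psiN; apply: eq_fsbigr => mu _; rewrite /truncate; case: eqP => // muN.
suff -> : psi mu = 0 by rewrite !mulr0.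
by apply/eqP/negPn/negP => /psiN.
Qed.

Lemma sesq_form_truncate N phi psi : in_sector N psi ->
  sesq_form kappa lambda phi psi = sesq_form kappa lambda (truncate N phi) psi.
Proof.
move=> psiN; rewrite /sesq_form; congr (_ + _ * _); apply: eq_fsbigr => mu _.
  rewrite /truncate; case: eqP => // muN.
  suff -> : psi mu = 0 by rewrite !mulr0.
  by apply/eqP/negPn/negP => /psiN.
apply: eq_bigr => x _; have [muN|muN] := eqVneq (particles mu + 2)%N N.
  by rewrite q_truncate.
by rewrite (q_eq0 _ psiN muN) !mulr0.
Qed.

Lemma inner_sector N phi psi : in_sector N psi ->
  inner phi psi = \sum_(mu <- configs_le L N) (phi mu)^* * psi mu.
Proof.
move=> psiN; apply: sum_configs_le => mu; rewrite mulf_eq0 negb_or => /andP[_].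
by move/psiN ->.
Qed.

Lemma sesq_form_sector N phi psi : in_sector N psi ->
  sesq_form kappa lambda phi psi =
  \sum_(mu <- configs_le L N) (pair_energy mu)%:R * ((phi mu)^* * psi mu)
  + kappa%:C * \sum_(nu <- configs_le L N)
      \sum_x (q lambda x phi nu)^* * q lambda x psi nu.
Proof.
move=> psiN; rewrite /sesq_form; congr (_ + _ * _); apply: sum_configs_le => mu.
  by rewrite !mulf_eq0 !negb_or => /andP[_ /andP[_ /psiN ->]].
apply: contraNT; rewrite -ltnNge => muN; rewrite big1// => x _.
by rewrite (q_eq0 _ psiN) ?mulr0// gtn_eqF// ltn_addr.
Qed.

(** Finite, real-valued counterpart of [quad_form] for sector states, as [mass] is of [sqnorm]. *)
Definition energy N psi : R :=
  \sum_(mu <- configs_le L N) (pair_energy mu)%:R * normc (psi mu) ^+ 2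
  + kappa * \sum_(nu <- configs_le L N) \sum_x normc (q lambda x psi nu) ^+ 2.

Definition mass N psi : R := \sum_(mu <- configs_le L N) normc (psi mu) ^+ 2.

Lemma inner_diag N psi : in_sector N psi -> inner psi psi = (mass N psi)%:C.
Proof.
move=> psiN; rewrite (inner_sector _ psiN) rmorph_sum.
by apply: eq_bigr => mu _; rewrite mulCJ.
Qed.

Lemma sesq_form_diag N psi : in_sector N psi ->
  sesq_form kappa lambda psi psi = (energy N psi)%:C.
Proof.
move=> psiN; rewrite (sesq_form_sector _ psiN) rmorphD rmorphM/= !rmorph_sum.
congr (_ + _ * _); apply: eq_bigr => mu _.
  by rewrite mulCJ [RHS]rmorphM rmorph_nat.
by rewrite rmorph_sum; apply: eq_bigr => x _; rewrite mulCJ.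
Qed.

Lemma mass_gt0 N psi :
  in_sector N psi -> (exists mu, psi mu != 0) -> 0 < mass N psi.
Proof.
move=> psiN [mu mu0]; rewrite lt_def sumr_ge0 ?andbT; last first.
  by move=> nu _; rewrite sqr_ge0.
rewrite psumr_eq0; last by move=> nu _; rewrite sqr_ge0.
apply/allPn; exists mu; first by rewrite mem_configs_le (psiN _ mu0).
by rewrite /= sqrf_eq0; apply: contra mu0 => /eqP/eq0_normc ->.
Qed.

(* [|u - v|^2 >= |u|^2 / 2 - |v|^2], then the configurations are shifted so that
   both squares become diagonal; the shift loses the terms with too few
   particles, which vanish in the first square and only help in the second. *)
Lemma sum_q_ge N psi x : in_sector N psi ->
  \sum_(mu <- configs_le L N)
     ((mu x * (mu x).-1)%N%:R / 2
      - normc lambda ^+ 2 * (mu (ord_pred x) * mu (ordS x))%N%:R)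
     * normc (psi mu) ^+ 2
  <= \sum_(nu <- configs_le L N) normc (q lambda x psi nu) ^+ 2.
Proof.
move=> psiN; pose w mu := normc (psi mu) ^+ 2.
have wN (c : config L -> R) mu : c mu * w mu != 0 -> (particles mu <= N)%N.
  rewrite mulf_eq0 negb_or => /andP[_ w0]; rewrite (psiN mu)//.
  by apply: contra w0; rewrite /w => /eqP ->; rewrite normc0 expr0n.
pose g1 mu := (mu x * (mu x).-1)%N%:R * w mu.
pose g2 mu := (mu (ord_pred x) * mu (ordS x))%N%:R * w mu.
pose d1 := delta x *+ 2; pose d2 := delta (ord_pred x) + delta (ordS x).
have E1 : \sum_(nu <- configs_le L N) g1 (nu + d1)
    = \sum_(mu <- configs_le L N) g1 mu.
  apply: sum_shift; first exact: (wN (fun mu => (mu x * (mu x).-1)%N%:R)).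
  move=> mu; rewrite mulf_eq0 negb_or pnatr_eq0 => /andP[mux _].
  (* The weight [mu_x (mu_x - 1)] is nonzero only if [mu_x >= 2], so this subtraction of naturals is
     exact. *)
  exists [ffun y => mu y - d1 y]%N; apply/ffunP => y.
  rewrite configDE ffunE subnK//.
  rewrite /d1 mulr2n configDE !ffunE; case: eqVneq => // ->.
  by case: (mu x) mux => [|[]].
(* Only an inequality: on a ring of one or two sites the two neighbours of [x] coincide, and [g2]
   need not vanish off the range of the shift. *)
have E2 : \sum_(nu <- configs_le L N) g2 (nu + d2)
    <= \sum_(mu <- configs_le L N) g2 mu.
  apply: sum_shift_le => [mu|]; last first.
    exact: (wN (fun mu => (mu (ord_pred x) * mu (ordS x))%N%:R)).
  by rewrite mulr_ge0// sqr_ge0.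
pose l := normc lambda ^+ 2.
have l0 : 0 <= l by rewrite sqr_ge0.
apply: (@le_trans _ _ (\sum_(nu <- configs_le L N)
                          (g1 (nu + d1) / 2 - l * g2 (nu + d2)))).
  rewrite sumrB -mulr_suml E1 -mulr_sumr.
  rewrite (eq_bigr (fun mu => g1 mu / 2 - l * g2 mu)); last first.
    by move=> mu _; rewrite /g1 /g2 /w /l; ring.
  by rewrite sumrB -mulr_suml -mulr_sumr lerB// ler_wpM2l.
apply: ler_sum => nu _; rewrite /q; apply: le_trans (normc_sqrB_ge _ _).
rewrite normc_sqr_natsqrt -[lambda * _ * _]mulrA normcM exprMn.
rewrite normc_sqr_natsqrt -/l.
rewrite -addrA -/d1 -/d2; apply: lerB.
  rewrite /g1 /w /d1 mulr2n !configDE !ffunE eqxx.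
  by rewrite addn2 /= mulnC addn1.
apply: ler_wpM2l => //; apply: ler_wpM2r; first exact: sqr_ge0.
(* Equality for distinct neighbours; if they coincide, [d2] puts two particles on that site, which
   enlarges the right-hand side. *)
rewrite ler_nat /d2 !configDE !ffunE !eqxx.
by apply: leq_mul; rewrite leq_add2l ?leq_addr ?leq_addl.
Qed.

(** Summing [sum_q_ge] over the sites leaves a diagonal operator [V], to which [density_form_ge]
    applies at each configuration with [c = kappa] and [l = kappa |lambda|^2]. *)
Lemma energy_ge N psi (nu : R) : 0 < kappa ->
    normc lambda ^+ 2 < (kappa - 2) / (2 * kappa) -> N%:R = nu * L%:R ->
    in_sector N psi ->
  nu * L%:R * (nu * (1 + kappa / 2 - kappa * normc lambda ^+ 2) - kappa / 2)
  * mass N psi <= energy N psi.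
Proof.
move=> k0 lk N_eq psiN; set l := normc lambda ^+ 2 in lk *.
have l0 : 0 <= l by rewrite sqr_ge0.
have kl : 0 <= kappa / 2 - 1 - kappa * l.
  move: lk; rewrite ltr_pdivlMr ?mulr_gt0// => lk.
  by rewrite -(pmulr_rge0 _ (ltr0n R 2)); lra.
pose V mu : R := \sum_x ((mu x * mu (ordS x))%N%:R
  + kappa * ((mu x * (mu x).-1)%N%:R / 2
             - l * (mu (ord_pred x) * mu (ordS x))%N%:R)).
apply: (@le_trans _ _ (\sum_(mu <- configs_le L N) V mu * normc (psi mu) ^+ 2)).
  rewrite mulr_sumr; apply: ler_sum => mu _.
  have [->|mu0] := eqVneq (psi mu) 0; first by rewrite normc0 expr0n/= !mulr0.
  apply: ler_wpM2r; first exact: sqr_ge0.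
  have sum_mu : \sum_x ((mu x)%:R : R) = nu * L%:R.
    by rewrite -natr_sum -N_eq -(psiN _ mu0).
  have dens := density_form_ge (mulr_ge0 (ltW k0) l0) kl sum_mu.
  rewrite [leLHS]mulrBr lerBlDr; apply: le_trans dens _.
  (* The term [- kappa / 2] is the linear part of [kappa mu_x (mu_x - 1) / 2], as the occupation
     numbers sum to [nu * L]. *)
  rewrite -sum_mu [leRHS]addrC mulr_suml -big_split/=; apply: ler_sum => x _.
  rewrite le_eqVlt; apply/orP; left; apply/eqP; rewrite !natrM.
  (* At [mu x = 0], where the predecessor is cut off at 0, both sides vanish. *)
  have -> : (mu x)%:R * (mu x).-1%:R = (mu x)%:R * ((mu x)%:R - 1) :> R.
    by case: (mu x) => [|n]; rewrite ?mul0r//= -natr1 addrK.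
  by field.
rewrite /energy exchange_big/= mulr_sumr.
have -> : \sum_(mu <- configs_le L N) V mu * normc (psi mu) ^+ 2 =
    \sum_(mu <- configs_le L N) (pair_energy mu)%:R * normc (psi mu) ^+ 2
    + \sum_x kappa * \sum_(mu <- configs_le L N)
     ((mu x * (mu x).-1)%N%:R / 2
      - l * (mu (ord_pred x) * mu (ordS x))%N%:R) * normc (psi mu) ^+ 2.
  rewrite -mulr_sumr exchange_big/= [X in _ = _ + X]mulr_sumr -big_split/=.
  apply: eq_bigr => mu _; rewrite /V big_split/= natr_sum mulrDl; congr (_ + _).
  by rewrite -mulr_sumr -mulr_suml mulrA.
rewrite lerD2l; apply: ler_sum => x _; rewrite ler_pM2l//.
exact: sum_q_ge.
Qed.

End Sector.

(** * Eigenvectors of the operator in a sector *)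

Section Eigenvalues.
Context (R : realType) (L : nat).
Variables (kappa : R) (lambda : R[i]).
Implicit Types (phi psi : state R L) (mu : config L) (N : nat).

Lemma fin_comb_sector N psi : in_sector N psi -> fin_comb psi.
Proof.
move=> psiN; apply: sub_finite_set (finite_particles_le L N) => mu /= mu0.
by rewrite (psiN mu mu0).
Qed.

Lemma in_sectorZ N psi (z : R[i]) :
  in_sector N psi -> in_sector N (fun mu => z * psi mu).
Proof. by move=> psiN mu; rewrite mulf_eq0 negb_or => /andP[_ /psiN]. Qed.

Lemma innerZ N phi psi (z : R[i]) : in_sector N psi ->
  inner phi (fun mu => z * psi mu) = z * inner phi psi.
Proof.
move=> psiN; rewrite (inner_sector _ (in_sectorZ psiN)) (inner_sector _ psiN).
by rewrite mulr_sumr; apply: eq_bigr => mu _; rewrite mulrCA.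
Qed.

(** A sector state is a finite combination, hence an admissible test vector for its own eigenvalue
    equation. *)
Lemma eigenvalue_energy N psi (E : R) : in_sector N psi ->
  Hper kappa lambda psi (fun mu => E%:C * psi mu) ->
  energy kappa lambda N psi = E * mass N psi.
Proof.
move=> psiN [_ _ _ /(_ _ (fin_comb_sector psiN))].
rewrite (sesq_form_diag _ _ psiN) (innerZ _ _ psiN) (inner_diag psiN) -rmorphM.
exact: complexI.
Qed.

Lemma ell2_sector N psi : in_sector N psi -> ell2 psi.
Proof.
move=> psiN; rewrite /ell2 /sqnorm.
have fin := finite_particles_le L N.
rewrite [X in (X < _)%E](_ : _ =
    \esum_(mu in [set mu | (particles mu <= N)%N]) (normc (psi mu) ^+ 2)%:E)%E.
  rewrite esum_fset// => [|mu _]; last by rewrite lee_fin sqr_ge0.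
  by rewrite fsbig_finite// sumEFin ltry.
rewrite [LHS]esum_mkcond [RHS]esum_mkcond; apply: eq_esum => mu _.
rewrite in_setT; case: ifPn => // muN.
have -> : psi mu = 0; last by rewrite normc0 expr0n.
by apply/eqP; apply: contraNT muN => /psiN muN; rewrite inE/= muN.
Qed.

Lemma form_domain_sector N psi : in_sector N psi -> form_domain kappa lambda psi.
Proof.
move=> psiN eps eps0; exists psi; first exact: fin_comb_sector psiN.
have -> : psi \- psi = fun=> 0 by apply/funext => mu; rewrite /= subrr.
rewrite /sqnorm /quad_form !esum1 ?mule0 ?adde0 ?lte_fin// => mu _.
- by rewrite big1// => x _; rewrite /q !mulr0 subrr normc0 expr0n.
- by rewrite normc0 expr0n mulr0.
- by rewrite normc0 expr0n.
Qed.

(** * The matrix of the operator on a sector and its spectrum *)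

Section Basis.
Variable N : nat.

Definition sector_seq : seq (config L) :=
  [seq mu <- configs_le L N | particles mu == N].
Notation n := (size sector_seq).

Definition basis (i : 'I_n) : state R L :=
  fun mu => (mu == nth 0 sector_seq i)%:R.

Definition comb (v : 'rV[R[i]]_n) : state R L :=
  fun mu => \sum_i v 0 i * basis i mu.

Definition coords psi : 'rV[R[i]]_n :=
  \row_i psi (nth 0 sector_seq i).

Lemma mem_sector_seq mu : (mu \in sector_seq) = (particles mu == N).
Proof.
rewrite mem_filter mem_configs_le; case: eqP => //= ->.
exact: leqnn.
Qed.

Lemma comb_nth v (i : 'I_n) : comb v (nth 0 sector_seq i) = v 0 i.
Proof.
have u : uniq sector_seq by rewrite filter_uniq// finmap.fset_uniq.
rewrite /comb (bigD1 i)//= /basis eqxx mulr1 big1 ?addr0// => j ji.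
by rewrite /basis nth_uniq// (inj_eq val_inj) eq_sym (negbTE ji) mulr0.
Qed.


Lemma in_sector_basis i : in_sector N (basis i).
Proof.
move=> mu; rewrite pnatr_eq0 eqb0 negbK => /eqP ->.
by apply/eqP; rewrite -mem_sector_seq mem_nth.
Qed.

Lemma in_sector_comb v : in_sector N (comb v).
Proof.
move=> mu; apply: contra_neq_eq => muN; rewrite /comb big1// => i _.
have -> : basis i mu = 0; last exact: mulr0.
by apply: contra_neq_eq muN; exact: in_sector_basis.
Qed.

Lemma coordsK psi : in_sector N psi -> comb (coords psi) = psi.
Proof.
move=> psiN; apply/funext => mu; have [muN|muN] := eqVneq (particles mu) N.
  have mu_lt : (index mu sector_seq < n)%N.
    by rewrite index_mem mem_sector_seq muN.
  rewrite -(@nth_index _ 0 mu sector_seq) ?mem_sector_seq ?muN//.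
  by rewrite (comb_nth _ (Ordinal mu_lt)) mxE.
transitivity (0 : R[i]); last first.
  by apply/esym/eqP; apply: contraNT muN => /psiN ->.
by apply/eqP; apply: contraNT muN => /in_sector_comb ->.
Qed.

Lemma comb0 : comb 0 = fun=> 0.
Proof.
by apply/funext => mu; rewrite /comb big1// => i _; rewrite mxE mul0r.
Qed.

Lemma q_comb x v nu :
  q lambda x (comb v) nu = \sum_i v 0 i * q lambda x (basis i) nu.
Proof.
rewrite /q /comb !mulr_sumr -sumrB; apply: eq_bigr => i _.
by rewrite mulrBr; congr (_ - _); rewrite mulrCA.
Qed.

Lemma inner_comb v psi : in_sector N psi ->
  inner (comb v) psi = \sum_i (v 0 i)^* * inner (basis i) psi.
Proof.
move=> psiN; rewrite (inner_sector _ psiN).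
under [RHS]eq_bigr do rewrite (inner_sector _ psiN) mulr_sumr.
rewrite [RHS]exchange_big/=; apply: eq_bigr => mu _.
rewrite /comb rmorph_sum mulr_suml; apply: eq_bigr => i _.
by rewrite rmorphM mulrA.
Qed.

Lemma sesq_form_combl v psi : in_sector N psi ->
  sesq_form kappa lambda (comb v) psi
  = \sum_i (v 0 i)^* * sesq_form kappa lambda (basis i) psi.
Proof.
move=> psiN; rewrite (sesq_form_sector _ _ _ psiN).
under [RHS]eq_bigr do
  rewrite (sesq_form_sector _ _ _ psiN) mulrDr mulr_sumr mulrCA mulr_sumr.
rewrite [RHS]big_split/= -mulr_sumr; congr (_ + _ * _).
  rewrite [RHS]exchange_big/=; apply: eq_bigr => mu _.
  rewrite /comb [X in _ * (X * _) = _]rmorph_sum mulr_suml mulr_sumr.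
  apply: eq_bigr => i _.
  by rewrite rmorphM; ring.
rewrite [RHS]exchange_big/=; apply: eq_bigr => nu _.
under [RHS]eq_bigr do rewrite mulr_sumr.
rewrite [RHS]exchange_big/=; apply: eq_bigr => x _.
rewrite q_comb rmorph_sum mulr_suml; apply: eq_bigr => i _.
by rewrite rmorphM mulrA.
Qed.

Lemma sesq_form_combr phi v :
  sesq_form kappa lambda phi (comb v)
  = \sum_i v 0 i * sesq_form kappa lambda phi (basis i).
Proof.
rewrite (sesq_form_sector _ _ _ (@in_sector_comb v)).
under [RHS]eq_bigr => i _ do
  rewrite (sesq_form_sector _ _ _ (@in_sector_basis i)) mulrDr mulr_sumr mulrCA
    mulr_sumr.
rewrite [RHS]big_split/= -mulr_sumr; congr (_ + _ * _).
  rewrite [RHS]exchange_big/=; apply: eq_bigr => mu _.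
  rewrite /comb !mulr_sumr; apply: eq_bigr => i _.
  by ring.
rewrite [RHS]exchange_big/=; apply: eq_bigr => nu _.
under [RHS]eq_bigr do rewrite mulr_sumr.
rewrite [RHS]exchange_big/=; apply: eq_bigr => x _.
rewrite q_comb mulr_sumr; apply: eq_bigr => i _.
by rewrite mulrCA.
Qed.

Lemma inner_basis i v : inner (basis i) (comb v) = v 0 i.
Proof.
rewrite (inner_sector _ (@in_sector_comb v)) (bigD1_seq (nth 0 sector_seq i))/=.
- rewrite /basis eqxx rmorph1 mul1r comb_nth big1 ?addr0// => mu.
  by move=> /negbTE ->; rewrite rmorph0 mul0r.
- by have := mem_nth 0 (ltn_ord i); rewrite mem_filter => /andP[].
- exact: finmap.fset_uniq.
Qed.

(* Row-vector convention: coordinates are multiplied by this matrix on the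
   right. *)
Definition sector_mx : 'M[R[i]]_n :=
  \matrix_(j, i) sesq_form kappa lambda (basis i) (basis j).

Lemma sesq_form_basis i v :
  sesq_form kappa lambda (basis i) (comb v) = (v *m sector_mx) 0 i.
Proof.
by rewrite sesq_form_combr mxE; apply: eq_bigr => j _; rewrite mxE.
Qed.

(** Testing against the basis vectors reads off the matrix equation entry by entry. Conversely, a
    test vector is truncated to the sector and expanded in the basis, both sides being antilinear in
    it. *)
Lemma Hper_comb (E : R) v :
  Hper kappa lambda (comb v) (fun mu => E%:C * comb v mu)
  <-> v *m sector_mx = E%:C *: v.
Proof.
have vN := @in_sector_comb v; split=> [[_ _ _ Hv]|Hv].
  apply/rowP => i; rewrite -sesq_form_basis Hv; last first.
    exact/fin_comb_sector/in_sector_basis.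
  by rewrite (innerZ _ _ vN) inner_basis mxE.
split; [exact: ell2_sector vN|exact: form_domain_sector vN|
  exact: (ell2_sector (in_sectorZ vN))|move=> phi _].
rewrite (sesq_form_truncate _ _ _ vN) (inner_truncate _ (in_sectorZ vN)).
rewrite -(coordsK (@in_sector_truncate _ _ _ _)) (sesq_form_combl _ vN).
rewrite (inner_comb _ (in_sectorZ vN)); apply: eq_bigr => i _.
rewrite sesq_form_basis Hv (innerZ _ _ vN) inner_basis.
by congr (_ * _); exact: mxE.
Qed.

Lemma sector_eigenvaluesP (E : R) :
  sector_eigenvalues L kappa lambda N E <-> eigenvalue sector_mx E%:C.
Proof.
split=> [[psi [psiN [mu mu0] Hpsi]]|/eigenvalueP[v Hv v0]].
  move: Hpsi mu0; rewrite -(coordsK psiN) => /Hper_comb Hv mu0.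
  apply/eigenvalueP; exists (coords psi) => //.
  by apply: contra_neq mu0 => ->; rewrite comb0.
exists (comb v); split; first exact: in_sector_comb.
- have [i vi] := rV0Pn _ v0.
  by exists (nth 0 sector_seq i); rewrite comb_nth.
- exact/Hper_comb.
Qed.

(** Testing the eigenvector against itself gives [energy = z * mass], with [energy] real and [mass]
    real and positive. *)
Lemma eigenvalue_real z : eigenvalue sector_mx z -> z = (complex.Re z)%:C.
Proof.
move=> /eigenvalueP[v Hv v0]; have vN := @in_sector_comb v.
have [i vi] := rV0Pn _ v0.
have : sesq_form kappa lambda (comb v) (comb v) = z * inner (comb v) (comb v).
  rewrite (sesq_form_combl _ vN) (inner_comb _ vN) mulr_sumr.
  apply: eq_bigr => j _.
  by rewrite sesq_form_basis Hv inner_basis mxE mulrCA.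
rewrite (sesq_form_diag _ _ vN) (inner_diag vN).
have /lt0r_neq0 m0 : 0 < mass N (comb v).
  by apply: mass_gt0 => //; exists (nth 0 sector_seq i); rewrite comb_nth.
move=> /(congr1 ( *%R^~ (mass N (comb v))^-1%:C)).
by rewrite -mulrA -!rmorphM/= divff// mulr1 => <-.
Qed.

Lemma min_sector_eigenvalue : (0 < n)%N -> exists E,
  (sector_eigenvalues L kappa lambda N `&`
   lbound (sector_eigenvalues L kappa lambda N)) E.
Proof.
move=> n0; have [rs char_rs] := closed_field_poly_normal (char_poly sector_mx).
have rsP z : (z \in rs) = eigenvalue sector_mx z.
  rewrite eigenvalue_root_char char_rs rootZ ?root_prod_XsubC//.
  by rewrite (monicP (char_poly_monic _)) oner_eq0.
(* The characteristic polynomial has size [n.+1], so comparing sizes in its factorization gives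
   [size rs = n]. *)
have rs0 : (0 < size rs)%N.
  have := size_char_poly sector_mx; rewrite char_rs.
  rewrite (monicP (char_poly_monic _)) scale1r size_prod_XsubC.
  by case=> ->.
have memS (E : R) : sector_eigenvalues L kappa lambda N E <-> E%:C \in rs.
  by rewrite rsP; exact: sector_eigenvaluesP.
have [k _ k_min] := @Order.TotalTheory.arg_minP _ _ 'I_(size rs)
  (Ordinal rs0) xpredT (fun k => complex.Re (rs`_k)) isT.
exists (complex.Re rs`_k); split.
  by apply/memS; rewrite -eigenvalue_real ?mem_nth// -rsP mem_nth.
move=> E /memS Ers; have kE : (index E%:C rs < size rs)%N by rewrite index_mem.
by have := k_min (Ordinal kE) isT; rewrite /= nth_index.
Qed.

End Basis.

End Eigenvalues.

Theorem proposition4p2 (R : realType) (kappa : R) (lambda : R[i]) (a b : int)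
    (kappa_gt0 : 0 < kappa) (lambda_neq0 : lambda != 0) (le_ab : a <= b)
    (lambda_small : normc lambda ^+ 2 < (kappa - 2) / (2 * kappa))
    (nu : R) (nu_gt1 : 1 < nu)
    (N : nat) (N_def : N%:R = nu * (sites a b)%:R) :
  nu * (sites a b)%:R
    * (nu * (1 + kappa / 2 - kappa * normc lambda ^+ 2) - kappa / 2)
  <= E0 (sites a b) kappa lambda N.
Proof.
(* Witness: all [N] particles on one site, which exists because [sites] is a successor. *)
have sector_nonempty : (0 < size (sector_seq (sites a b) N))%N.
  have: delta ord0 *+ N \in sector_seq (sites a b) N.
    by rewrite mem_sector_seq particlesMn particles_delta mul1n.
  by case: (sector_seq _ _).
have [[psi [psiN psi0 Hpsi]] _] :=
  xgetPex 0 (min_sector_eigenvalue kappa lambda sector_nonempty).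
(* Multiplying by the positive [mass] of the ground state turns the eigenvalue into its energy. *)
rewrite -(ler_pM2r (mass_gt0 psiN psi0)) -(eigenvalue_energy psiN Hpsi).
exact: energy_ge.
Qed.
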